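(* Let $\Gamma=(V_\Gamma,E_\Gamma,s,t)$ be a finite strongly connected $k$-out graph, and let $H$ be a nontrivial finite group. Assume that $|V_\Gamma|\ge d(H)$. Let $\Gamma^\sharp$ be the graph obtained from $\Gamma$ by adding exactly one loop at every vertex. Then $\Gamma^\sharp$ is a strongly connected $(k+1)$-out graph, and there exist a finite strongly connected $(k+1)$-out graph $G$ and a graph congruence $\rho$ on $G$ such that \[ G/\rho\cong \Gamma^\sharp,\qquad \operatorname{Aut}(G)/\operatorname{Aut}_E(G)\cong H, \] and $G$ is not totally synchronizing.
   Context: A graph is a finite directed multigraph $G=(V,E,s,t)$ with source and target maps $s,t:E\to V$ (loops and parallel edges allowed). It is $k$-out if every vertex has exactly $k$ outgoing edges. An isomorphism of graphs is a pair of bijections on vertices and on edges commuting with $s$ and $t$; $\operatorname{Aut}(G)$ is the group of automorphisms $\varphi=(\varphi_v,\varphi_e)$, and $\operatorname{Aut}_E(G)=\{\varphi\in\operatorname{Aut}(G):\varphi_v=\mathrm{id}_{V}\}$ is its (normal) subgroup of automorphisms fixing every vertex. $d(H)$ denotes the minimal size of a generating set of the group $H$. Given an equivalence relation $\rho$ on $V(G)$, the quotient $G/\rho$ has vertex set $V(G)/\rho$ and, for each pair of classes $C,D$, exactly $\max_{p\in C}|\{e\in E: s(e)=p,\ t(e)\in D\}|$ parallel edges from $C$ to $D$. For a $k$-out graph $G$, $\rho$ is a (graph) congruence if $G/\rho$ is again $k$-out; equivalently, for all classes $C,D$ all vertices of $C$ have the same number of outgoing edges ending in $D$. A coloring of a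 $k$-out graph $G$ is a map $\chi:E\to[k]=\{1,\dots,k\}$ whose restriction to the set of outgoing edges of each vertex is a bijection onto $[k]$. It defines the deterministic complete automaton $\chi(G)=(V,[k],\delta_\chi)$, where $\delta_\chi(v,a)=t(e)$ for the unique edge $e$ with $s(e)=v$, $\chi(e)=a$. The automaton is synchronizing if there is a word $w\in[k]^*$ with $|V\cdot w|=1$. $G$ is totally synchronizing if $\chi(G)$ is synchronizing for every coloring $\chi$ of $G$. *)

(* Defs.v *)
(* Rocq + MathComp: finite directed multigraphs, their quotients, their
   automorphism groups, and the automata obtained by colouring their edges. *)
From HB Require Import structures.
From mathcomp Require Import all_boot all_fingroup all_solvable.

Set Implicit Arguments.
Unset Strict Implicit.
Unset Printing Implicit Defensive.

Import GroupScope.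

Record digraph := Digraph {
  vert : finType;
  edge : finType;
  src : edge -> vert;
  tgt : edge -> vert }.

Section Graphs.

Variable G : digraph.

Definition out_edges (v : vert G) : {set edge G} := [set e | src e == v].

Definition k_out (k : nat) : Prop := forall v : vert G, #|out_edges v| = k.

Definition adj : rel (vert G) :=
  [rel u v | [exists e : edge G, (src e == u) && (tgt e == v)]].

(* [connect] is the reflexive transitive closure: paths may be empty. *)
Definition strongly_connected : Prop := forall u v : vert G, connect adj u v.

End Graphs.

Definition graph_morph (G G' : digraph)
    (fv : vert G -> vert G') (fe : edge G -> edge G') : bool :=
  [forall e : edge G, (src (fe e) == fv (src e)) && (tgt (fe e) == fv (tgt e))].

Definition graph_iso (G G' : digraph) : Prop :=
  exists (fv : vert G -> vert G') (fe : edge G -> edge G'),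
    [/\ bijective fv, bijective fe & graph_morph fv fe].

Definition add_loops (G : digraph) : digraph :=
  @Digraph (vert G) (edge G + vert G)%type
    (fun x => match x with inl e => src e | inr v => v end)
    (fun x => match x with inl e => tgt e | inr v => v end).

Section Quotient.

Variables (G : digraph) (rho : rel (vert G)).

Definition qvert : finType :=
  {C : {set vert G} | C \in equivalence_partition rho [set: vert G]}.

Definition qmult (CD : qvert * qvert) : nat :=
  \max_(p in val CD.1) #|[set e in out_edges p | tgt e \in val CD.2]|.

Definition qedge : finType := {CD : qvert * qvert & 'I_(qmult CD)}.

Definition quotient_graph : digraph :=
  @Digraph qvert qedge (fun x => (tag x).1) (fun x => (tag x).2).

(* Meant for a [k]-out graph [G]. *)
Definition graph_congruence (k : nat) : Prop :=
  equivalence_rel rho /\ k_out quotient_graph k.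

End Quotient.

Section Automorphisms.

Variable G : digraph.

(* Permutations multiply as [(s * t) x = t (s x)], the opposite of composition
   order; inversion is an isomorphism between the two conventions. *)
Definition AutG : {set {perm vert G} * {perm edge G}} :=
  [set f : {perm vert G} * {perm edge G} | @graph_morph G G f.1 f.2].

Lemma AutG_group_set : group_set AutG.
Proof.
apply/group_setP; split.
  by rewrite inE; apply/forallP => e; rewrite !perm1 !eqxx.
move=> f g; rewrite !inE => /forallP Hf /forallP Hg.
apply/forallP => e; rewrite /= !permM.
have /andP[/eqP-> /eqP->] := Hg (f.2 e).
by have /andP[/eqP-> /eqP->] := Hf e; rewrite !eqxx.
Qed.

Canonical AutG_group := Group AutG_group_set.

Definition AutE : {set {perm vert G} * {perm edge G}} :=
  [set f in AutG | f.1 == 1].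

Lemma AutE_group_set : group_set AutE.
Proof.
apply/group_setP; split; first by rewrite inE group1 eqxx.
move=> f g; rewrite inE => /andP[Hf /eqP f1]; rewrite inE => /andP[Hg /eqP g1].
by rewrite inE groupM //= f1 g1 mulg1 eqxx.
Qed.

Canonical AutE_group := Group AutE_group_set.

(* Needed for [AutG / AutE] to be the full quotient: in general [A / B] only
   involves the part of [A] normalising [B]. *)
Lemma AutE_normal : AutE <| AutG.
Proof.
apply/andP; split; first by apply/subsetP => f; rewrite inE => /andP[].
apply/subsetP => g Hg; rewrite inE; apply/subsetP => _ /imsetP[f + ->].
rewrite inE => /andP[Hf /eqP f1].
by rewrite inE groupJ //= f1 mul1g mulVg eqxx.
Qed.

End Automorphisms.

Definition synchronizing (Q : finType) (A : Type) (delta : Q -> A -> Q) : Prop :=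
  exists w : seq A, #|[set foldl delta q w | q : Q]| = 1%N.

Section Colorings.

Variables (G : digraph) (k : nat).

(* The colours [1, ..., k] are represented by ['I_k]. *)
Definition coloring (chi : edge G -> 'I_k) : Prop :=
  forall v : vert G,
    {in out_edges v &, injective chi} /\ chi @: out_edges v = [set: 'I_k].

(* The value [v] is never reached when [chi] is a coloring. *)
Definition coloring_delta (chi : edge G -> 'I_k) (v : vert G) (a : 'I_k) :
    vert G :=
  if [pick e in out_edges v | chi e == a] is Some e then tgt e else v.

(* Meant for a [k]-out graph [G]. *)
Definition totally_synchronizing : Prop :=
  forall chi : edge G -> 'I_k, coloring chi -> synchronizing (coloring_delta chi).

End Colorings.

(* Main.v *)
(* Enumerate the vertices of Gamma and pick generators (g v) of H, one per vertex
   (possible since d(H) <= |V|). Over the [r]-th vertex [v] put the fiber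
   {0, ..., r} x H, and lift the edges of Gamma with loops as follows: the new
   loop at [v] climbs from (i, t) to (i + 1, t), and from the top (r, t) it goes
   to (0, t * g v); an edge v -> w of Gamma leads from (i, t) to (0, t).
   The vertices at height 0 are exactly those with several incoming edges (when
   k > 0; otherwise Gamma has one vertex and all heights are 0), so every
   automorphism preserves heights, and the height of a tower identifies its
   base vertex. The edges of Gamma force the induced permutations of H to be the
   same over all vertices, and the top edges force this permutation to commute
   with right multiplication by the generators, i.e. to be a left multiplication.
   Left multiplications act freely on the vertices and preserve any coloring
   pulled back from Gamma with loops, so two states in the same orbit are never
   merged by a word. *)
Require Import Defs.
From HB Require Import structures.
From mathcomp Require Import all_boot all_fingroup all_solvable.

Set Implicit Arguments.
Unset Strict Implicit.
Unset Printing Implicit Defensive.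

Import GroupScope.

(** * Preliminaries on graph isomorphisms, colorings and automorphisms *)

Lemma inj_surj_bij (A B : finType) (f : A -> B) :
  injective f -> (forall b, exists a, f a == b) -> bijective f.
Proof.
move=> injf surjf; exists (fun b => xchoose (surjf b)) => [a|b].
  exact/injf/eqP/(xchooseP (surjf (f a))).
exact/eqP/(xchooseP (surjf b)).
Qed.

Lemma graph_iso_sym (G G' : digraph) : graph_iso G G' -> graph_iso G' G.
Proof.
case=> fv [fe [[gv fvK gvK] [ge feK geK] /forallP fm]].
exists gv, ge; split; [by exists fv | by exists fe |].
apply/forallP=> e; have /andP[/eqP s_e /eqP t_e] := fm (ge e).
by rewrite geK in s_e t_e; rewrite s_e t_e !fvK !eqxx.
Qed.

Lemma graph_iso_k_out (G G' : digraph) (k : nat) :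
  graph_iso G G' -> k_out G k -> k_out G' k.
Proof.
case=> fv [fe [[gv fvK gvK] [ge feK geK] /forallP fm]] kG v.
rewrite -(kG (gv v)) -(card_imset _ (can_inj feK)); apply: eq_card => e.
rewrite inE; apply/eqP/imsetP=> [<-|[d + ->]].
  exists (ge e); last by rewrite geK.
  by have /andP[/eqP + _] := fm (ge e); rewrite inE geK => ->; rewrite fvK.
by rewrite inE => /eqP sd; have /andP[/eqP-> _] := fm d; rewrite sd gvK.
Qed.

Lemma exists_coloring (G : digraph) (k : nat) :
  k_out G k.+1 -> exists chi : edge G -> 'I_k.+1, coloring chi.
Proof.
move=> kG; pose chi (e : edge G) : 'I_k.+1 :=
  inord (index e (enum (out_edges (src e)))).
have inj v : {in out_edges v &, injective chi}.
  move=> d e dv ev; have := dv; have := ev; rewrite !inE => /eqP se /eqP sd.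
  move/(congr1 val); rewrite /chi /= sd se !inordK.
  - by move/(congr1 (nth d (enum (out_edges v)))); rewrite !nth_index ?mem_enum.
  - by rewrite -(kG v) cardE index_mem mem_enum.
  - by rewrite -(kG v) cardE index_mem mem_enum.
exists chi => v; split; first exact: inj.
apply/eqP; rewrite eqEcard subsetT cardsT card_ord.
by rewrite (card_in_imset (inj v)) kG leqnn.
Qed.

Lemma coloring_deltaE (G : digraph) (k : nat) (chi : edge G -> 'I_k) (e : edge G) :
  coloring chi -> coloring_delta chi (src e) (chi e) = tgt e.
Proof.
move=> col; rewrite /coloring_delta; case: pickP => [d /andP[ds /eqP]|/(_ e)].
  by move/(proj1 (col (src e))) => -> //; rewrite inE.
by rewrite inE !eqxx.
Qed.

Lemma AutG_inv (G : digraph) f : f \in AutG G -> f^-1 \in AutG G.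
Proof. by rewrite (groupV (AutG_group G)). Qed.

Lemma aut_src (G : digraph) f (e : edge G) :
  f \in AutG G -> src (f.2 e) = f.1 (src e).
Proof. by rewrite inE => /forallP/(_ e)/andP[/eqP]. Qed.

Lemma aut_tgt (G : digraph) f (e : edge G) :
  f \in AutG G -> tgt (f.2 e) = f.1 (tgt e).
Proof. by rewrite inE => /forallP/(_ e)/andP[_ /eqP]. Qed.

Lemma aut_adj (G : digraph) f (x y : vert G) :
  f \in AutG G -> adj x y -> adj (f.1 x) (f.1 y).
Proof.
move=> fA /existsP[e /andP[/eqP sx /eqP ty]]; apply/existsP; exists (f.2 e).
by rewrite aut_src // aut_tgt // sx ty !eqxx.
Qed.

(** First isomorphism theorem for the projection to vertex permutations, whose kernel on [AutG G] is
    [AutE G]. *)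
Lemma quotient_Aut_isog (G : digraph) (K : {group {perm vert G}}) :
  [set f.1 | f in AutG G] = K -> AutG G / AutE G \isog K.
Proof.
move=> <-; have -> : [set f.1 | f in AutG G] = [morphism of fst] @* AutG G.
  by rewrite morphimEsub //; apply: subsetT.
have -> : AutE G = 'ker_(AutG G) [morphism of fst].
  by apply/setP=> f; rewrite [LHS]inE [RHS]inE; congr (_ && _); rewrite !inE.
apply: (first_isog_loc _ (G := [group of setT]) (H := AutG_group G)).
exact: subsetT.
Qed.

(** * Lifts of a graph *)

Section Lift.

Variables (B : digraph) (X : finType) (p : X -> vert B) (act : X -> edge B -> X).

(* When [act x e] lies over [tgt e], the projection [p] identifies the edges
   leaving [x] with the edges of [B] leaving [p x]. *)
Definition lift_edge : finType := {z : X * edge B | src z.2 == p z.1}.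

Definition lift_graph : digraph :=
  @Digraph X lift_edge (fun z => (val z).1) (fun z => act (val z).1 (val z).2).

Definition lift_out (x : X) (e : edge B) (se : src e == p x) : edge lift_graph :=
  exist (fun z : X * edge B => src z.2 == p z.1) (x, e) se.

Lemma lift_adjP (x y : X) :
  reflect (exists2 e, src e = p x & act x e = y) (@adj lift_graph x y).
Proof.
apply: (iffP existsP) => [[[[x' e] /= se] /andP[/eqP /= <- /eqP <-]]|[e se <-]].
  by exists e => //; apply/eqP.
by exists (lift_out (introT eqP se)); rewrite /= !eqxx.
Qed.

Hypothesis p_act : forall x e, src e = p x -> p (act x e) = tgt e.

(** A lifted edge out of [x] is determined by its edge of [B]. The predicate [P] will be [xpredT] to
    count degrees and [pred1 w] to count edges into one fiber. *)
Lemma card_lift_out (P : pred (vert B)) (x : X) :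
  #|[set z in @out_edges lift_graph x | P (p (tgt z))]|
  = #|[set e in out_edges (p x) | P (tgt e)]|.
Proof.
rewrite -(card_in_imset (f := fun z : lift_edge => (val z).2)); last first.
  move=> [[y d] /= sd] [[z e] /= se]; rewrite !inE /=.
  move=> /andP[/eqP yx _] /andP[/eqP zx _] de.
  by apply: val_inj; rewrite /= yx zx de.
apply: eq_card => e; apply/imsetP/idP.
  case=> [[[y d] /= sd]]; rewrite !inE /= => /andP[/eqP yx Pd] ->.
  by move: Pd; rewrite p_act ?(eqP sd) // yx eqxx.
rewrite !inE => /andP[sx Pe].
exists (lift_out sx) => //.
by rewrite !inE eqxx /= p_act //; apply/eqP.
Qed.

Lemma lift_k_out k : k_out B k -> k_out lift_graph k.
Proof.
move=> kB x; rewrite -(kB (p x)).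
have := card_lift_out xpredT x; rewrite !setIdE.
have T0 (A : finType) : [set x : A | true] = setT by apply/setP=> a; rewrite !inE.
by rewrite !T0 !setIT.
Qed.

Hypothesis p_surj : forall v, exists x, p x = v.

Definition fiber_rel : rel (vert lift_graph) := fun x y => p x == p y.

Lemma fiber_rel_equiv : equivalence_rel fiber_rel.
Proof. by move=> x y z; split=> [|/eqP]; rewrite /fiber_rel // => ->. Qed.

Lemma fiber_in_partition v :
  [set x | p x == v] \in equivalence_partition fiber_rel [set: X].
Proof.
have [x <-] := p_surj v; apply/imsetP; exists x => //.
by apply/setP=> y; rewrite !inE eq_sym.
Qed.

Definition fiber v : qvert fiber_rel :=
  exist (fun C => C \in equivalence_partition fiber_rel _) _ (fiber_in_partition v).

Lemma fiber_inj : injective fiber.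
Proof.
move=> v w /(congr1 val) /= /setP e; have [x xv] := p_surj v.
by move: (e x); rewrite !inE xv eqxx => /esym/eqP.
Qed.

Lemma fiber_onto C : exists v, fiber v == C.
Proof.
case: C => C CP; have /imsetP[x _ Cx] := CP; exists (p x).
by apply/eqP/val_inj; rewrite /= Cx; apply/setP=> y; rewrite !inE eq_sym.
Qed.

(** All vertices of a fiber have the same count by [card_lift_out], so the maximum in [qmult] is
    this common value; fibers are nonempty by [p_surj]. *)
Lemma qmult_fiber v w :
  qmult (fiber v, fiber w) = #|[set e in out_edges v | tgt e == w]|.
Proof.
have cnt (x : X) : p x = v ->
    #|[set z in @out_edges lift_graph x | tgt z \in val (fiber w)]|
    = #|[set e in out_edges v | tgt e == w]|.
  move=> <-; rewrite -(card_lift_out (pred1 w)); apply: eq_card => z.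
  by rewrite !inE.
rewrite /qmult /=; apply/eqP; rewrite eqn_leq; apply/andP; split.
  by apply/bigmax_leqP=> x; rewrite inE => /eqP/cnt <-.
have [x xv] := p_surj v; rewrite -(cnt _ xv).
by apply: (@leq_bigmax_cond _ _ _ x); rewrite inE xv.
Qed.

Lemma fiber_index_lt (e : edge B) :
  index e (enum [set d in out_edges (src e) | tgt d == tgt e])
  < qmult (fiber (src e), fiber (tgt e)).
Proof. by rewrite qmult_fiber cardE index_mem mem_enum !inE !eqxx. Qed.

Lemma lift_quotient_iso : graph_iso (quotient_graph fiber_rel) B.
Proof.
apply: graph_iso_sym; exists fiber.
(* An edge is sent to its index among the edges of [B] with the same endpoints. *)
pose fe e : edge (quotient_graph fiber_rel) :=
  existT (fun CD => 'I_(qmult CD)) (fiber (src e), fiber (tgt e))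
    (Ordinal (fiber_index_lt e)).
exists fe; split.
- by apply: inj_surj_bij; [exact: fiber_inj | exact: fiber_onto].
- apply: inj_surj_bij => [d e de|[[C D] i]].
    have /fiber_inj sde : fiber (src d) = fiber (src e)
      by exact: (congr1 (@src (quotient_graph fiber_rel)) de).
    have /fiber_inj tde : fiber (tgt d) = fiber (tgt e)
      by exact: (congr1 (@tgt (quotient_graph fiber_rel)) de).
    have := congr1 (fun z : qedge fiber_rel => val (tagged z)) de; rewrite /= sde tde.
    move/(congr1 (nth d (enum [set c in out_edges (src e) | tgt c == tgt e]))).
    by rewrite !nth_index // mem_enum !inE ?sde ?tde !eqxx.
  have [v /eqP Cv] := fiber_onto C; have [w /eqP Dw] := fiber_onto D.
  subst C D.
  pose A := [set e in out_edges v | tgt e == w].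
  pose e := enum_val (cast_ord (qmult_fiber v w) i : 'I_#|A|).
  have := enum_valP (cast_ord (qmult_fiber v w) i : 'I_#|A|).
  rewrite -/e !inE => /andP[/eqP se /eqP te].
  have idx : index e (enum A) = i.
    rewrite /e (enum_val_nth e) index_uniq ?enum_uniq // -cardE.
    exact: (ltn_ord (cast_ord (qmult_fiber v w) i : 'I_#|A|)).
  (* The bound proof is generalized so that the endpoints can be rewritten inside the dependent
     pair. *)
  exists e; apply/eqP; rewrite /fe; move: (fiber_index_lt e); rewrite se te => lt.
  by congr existT; apply: val_inj.
- by apply/forallP=> e; rewrite /= !eqxx.
Qed.

Lemma fiber_congruence k : k_out B k -> graph_congruence fiber_rel k.
Proof.
move=> kB; split; first exact: fiber_rel_equiv.
exact: (graph_iso_k_out (graph_iso_sym lift_quotient_iso)).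
Qed.

Variable a : {perm X}.
Hypothesis p_a : forall x, p (a x) = p x.
Hypothesis act_a : forall x e, act (a x) e = a (act x e).

Lemma lift_aut_proof (z : lift_edge) : src (val z).2 == p (a (val z).1).
Proof. by rewrite p_a (valP z). Qed.

Lemma lift_aut : exists2 f, f \in AutG lift_graph & f.1 = a.
Proof.
pose fe z : lift_edge := exist _ (a (val z).1, (val z).2) (lift_aut_proof z).
have fe_inj : injective fe.
  move=> [[x d] sd] [[y e] se] /(congr1 val) /= [/perm_inj xy de].
  by apply: val_inj; rewrite /= xy de.
exists (a, perm fe_inj) => //; rewrite inE; apply/forallP=> z.
by rewrite permE /= act_a !eqxx.
Qed.

(* A coloring pulled back from [B] is invariant under [a], so the image of a word
   is stable under the fixed-point-free [a]. *)
Lemma lift_not_totally_synchronizing k (x0 : X) :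
  k_out B k.+1 -> (forall x, a x != x) -> ~ totally_synchronizing lift_graph k.+1.
Proof.
move=> kB afree ts; have [c col] := exists_coloring kB.
pose chi (z : edge lift_graph) := c (val z).2.
have colchi : coloring chi.
  move=> x; have [injc surjc] := col (p x).
  split=> [[[y d] sd] [[z e] se]|].
    rewrite !inE /= => /eqP yx /eqP zx cde.
    apply: val_inj; rewrite /= yx zx; congr (_, _); apply: injc cde; rewrite inE.
      by rewrite -yx.
    by rewrite -zx.
  apply/setP=> i; rewrite inE; have : i \in c @: out_edges (p x) by rewrite surjc inE.
  case/imsetP=> e; rewrite inE => se ->.
  apply/imsetP; exists (lift_out se) => //.
  by rewrite inE.
have deltaE x e : src e = p x -> coloring_delta chi x (c e) = act x e.
  by move/eqP=> se; apply: (coloring_deltaE (lift_out se) colchi).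
have delta_a x i : coloring_delta chi (a x) i = a (coloring_delta chi x i).
  have : i \in c @: out_edges (p x) by rewrite (proj2 (col (p x))) inE.
  by case/imsetP=> e; rewrite inE => /eqP se ->; rewrite !deltaE ?p_a ?act_a.
have [w] := ts chi colchi; move/eqP/cards1P => [y imw].
have foldE x : foldl (coloring_delta chi) (a x) w = a (foldl (coloring_delta chi) x w).
  by elim: w x {imw} => //= i w IH x; rewrite delta_a IH.
have toy x : foldl (coloring_delta chi) x w = y.
  by apply/set1P; rewrite -imw; apply/imsetP; exists x.
by have := afree y; rewrite -{1}(toy x0) -foldE toy eqxx.
Qed.

End Lift.

Lemma add_loops_connected (G : digraph) :
  strongly_connected G -> strongly_connected (add_loops G).
Proof.
move=> cG u v; apply: (connect_sub _ (cG u v)) => x y /existsP[e ste].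
by apply: connect1; apply/existsP; exists (inl e).
Qed.

Lemma add_loops_k_out (G : digraph) k : k_out G k -> k_out (add_loops G) k.+1.
Proof.
move=> kG v; rewrite -sum1dep_card big_sumType /= sum1dep_card (kG v).
by rewrite big_pred1_eq addn1.
Qed.

(** * Towers over Gamma with loops *)

Section Tower.

Variables (Gamma : digraph) (k : nat) (T : finGroupType) (g : vert Gamma -> T).
Hypotheses (kG : k_out Gamma k) (cG : strongly_connected Gamma).
Hypothesis g_gen : <<[set g v | v : vert Gamma]>> = [set: T].

Definition rk (v : vert Gamma) : nat := enum_rank v.

Definition tower : finType := ({v : vert Gamma & 'I_(rk v).+1} * T)%type.

Definition base (x : tower) : vert Gamma := tag x.1.
Definition pos (x : tower) : nat := tagged x.1.

(* Meaningful for [i <= rk v]. *)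
Definition mk (v : vert Gamma) (i : nat) (t : T) : tower :=
  (existT (fun v => 'I_(rk v).+1) v (inord i), t).

Definition climb (x : tower) (e : edge (add_loops Gamma)) : tower :=
  match e with
  | inl e => mk (tgt e) 0 x.2
  | inr _ => if pos x < rk (base x) then mk (base x) (pos x).+1 x.2
             else mk (base x) 0 (x.2 * g (base x))
  end.

Definition tower_graph : digraph :=
  @lift_graph (add_loops Gamma) tower base climb.

Lemma rk_inj : injective rk.
Proof. by move=> v w /val_inj/enum_rank_inj. Qed.

Lemma pos_le x : pos x <= rk (base x).
Proof. by rewrite -ltnS ltn_ord. Qed.

Lemma mkE x : mk (base x) (pos x) x.2 = x.
Proof. by case: x => [[v i] t]; rewrite /mk /= inord_val. Qed.

Lemma mk_pos v i t : i <= rk v -> pos (mk v i t) = i.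
Proof. by move=> le_i; rewrite /pos /= inordK. Qed.

Lemma base_climb x (e : edge (add_loops Gamma)) :
  src e = base x -> base (climb x e) = tgt e.
Proof. by case: e => //= v ->; rewrite fun_if if_same. Qed.

Lemma base_onto v : exists x, base x = v.
Proof. by exists (mk v 0 1). Qed.

(** * Edges and strong connectivity of the tower graph *)

Lemma adj_next v i t :
  i < rk v -> @adj tower_graph (mk v i t) (mk v i.+1 t).
Proof.
move=> lt_i; apply/lift_adjP; exists (inr v) => //=.
by rewrite mk_pos ?(ltnW lt_i) //= lt_i.
Qed.

Lemma adj_reset v t : @adj tower_graph (mk v (rk v) t) (mk v 0 (t * g v)).
Proof.
by apply/lift_adjP; exists (inr v) => //=; rewrite mk_pos // ltnn.
Qed.

Lemma adj_cross (e : edge Gamma) i t :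
  @adj tower_graph (mk (src e) i t) (mk (tgt e) 0 t).
Proof. by apply/lift_adjP; exists (inl e). Qed.

Lemma tower_adj x y : @adj tower_graph x y ->
  [\/ [/\ pos x < rk (base x) & y = mk (base x) (pos x).+1 x.2],
      [/\ pos x = rk (base x) & y = mk (base x) 0 (x.2 * g (base x))] |
      exists2 e : edge Gamma, src e = base x & y = mk (tgt e) 0 x.2].
Proof.
case/lift_adjP=> -[e|v] /= sx <-; first by apply: Or33; exists e.
case: ltnP => le_x; [exact: Or31 | apply: Or32].
by split=> //; apply/eqP; rewrite eqn_leq pos_le.
Qed.

(** [P] cuts out a subgroup, since in a finite group closure under products suffices. *)
Lemma gen_ind (P : pred T) :
  P 1 -> (forall s t, P s -> P t -> P (s * t)) -> (forall v, P (g v)) ->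
  forall t, P t.
Proof.
move=> P1 PM Pg t.
have gP : group_set [set s | P s].
  by apply/group_setP; split=> [|s u]; rewrite !inE //; apply: PM.
have : t \in <<[set g v | v : vert Gamma]>> by rewrite g_gen inE.
have /subsetP sub : <<[set g v | v : vert Gamma]>> \subset Group gP.
  by rewrite gen_subG; apply/subsetP=> _ /imsetP[v _ ->]; rewrite inE.
by move/sub; rewrite inE.
Qed.

(** From [x], climb to the top and reset to height 0, adjust base vertex and group coordinate there,
    then climb to [y]. *)
Lemma tower_connected : strongly_connected tower_graph.
Proof.
pose conn := connect (@adj tower_graph).
have up v i t : i <= rk v -> conn (mk v 0 t) (mk v i t).
  elim: i => [|i IH] lt_i; first exact: connect0.
  by apply: connect_trans (IH (ltnW lt_i)) _; apply/connect1/adj_next.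
have up_top v i t : i <= rk v -> conn (mk v i t) (mk v (rk v) t).
  move=> le_i; rewrite -{1}(subKn le_i).
  have: rk v - i <= rk v by apply: leq_subr.
  elim: (rk v - i) => [|d IH] lt_d; first by rewrite subn0; apply: connect0.
  apply: connect_trans (IH (ltnW lt_d)); apply/connect1.
  rewrite -[rk v - d]subSS -/(subn _ _) subSn //.
  by apply: adj_next; rewrite -subn_gt0 subKn.
have reset x : conn x (mk (base x) 0 (x.2 * g (base x))).
  rewrite -{1}(mkE x); apply: connect_trans (up_top _ _ _ (pos_le x)) _.
  exact/connect1/adj_reset.
have cross v w t : conn (mk v 0 t) (mk w 0 t).
  have /connectP[q] := cG v w.
  elim: q v => [|u q IH] v /= => [_ ->|/andP[/existsP[e] ]]; first exact: connect0.
  move=> /andP[/eqP <- /eqP eu] qp wq; apply: connect_trans (IH u qp wq).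
  by rewrite -eu; apply/connect1/adj_cross.
have shift t v s : conn (mk v 0 s) (mk v 0 (s * t)).
  (* Boolean quantifiers turn the claim into a predicate on [t] to which [gen_ind] applies. *)
  suff: [forall v, forall s, connect (@adj tower_graph) (mk v 0 s) (mk v 0 (s * t))].
    by move/forallP/(_ v)/forallP/(_ s).
  move: t {v s}; apply: gen_ind => [|t u Pt Pu|w].
  - by apply/forallP=> v; apply/forallP=> s; rewrite mulg1 connect0.
  - apply/forallP=> v; apply/forallP=> s; rewrite mulgA.
    move/forallP/(_ v)/forallP/(_ s): Pt => Pt.
    by move/forallP/(_ v)/forallP/(_ (s * t)): Pu; apply: connect_trans.
  (* Cross to the tower of [w], go once around it to multiply by [g w], and cross back to [v]. *)
  - apply/forallP=> v; apply/forallP=> s; apply: connect_trans (cross v w s) _.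
    by apply: connect_trans (reset (mk w 0 s)) _; apply: cross.
move=> x y; apply: connect_trans (reset x) _; rewrite -(mkE y).
apply: connect_trans (cross _ (base y) _) _; apply: connect_trans (up _ _ _ (pos_le y)).
by have := shift ((x.2 * g (base x))^-1 * y.2) (base y) (x.2 * g (base x)); rewrite mulKVg.
Qed.

(** * Left multiplications *)

(* The inverse turns the reversed product of permutations into a morphism. *)
Definition left_mul_fun (s : T) (x : tower) : tower := (x.1, s^-1 * x.2).

Lemma left_mul_inj s : injective (left_mul_fun s).
Proof. by move=> [x t] [y u] [-> /mulgI ->]. Qed.

Definition left_mul s : {perm tower} := perm (@left_mul_inj s).

Lemma left_mulE s x : left_mul s x = (x.1, s^-1 * x.2).
Proof. exact: permE. Qed.

Lemma left_mulM : {in [set: T] &, {morph left_mul : s t / s * t}}.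
Proof.
by move=> s t _ _; apply/permP=> x; rewrite permM !left_mulE /= invMg mulgA.
Qed.

Canonical left_mul_morphism := Morphism left_mulM.

Lemma injm_left_mul (v : vert Gamma) : 'injm left_mul.
Proof.
apply/injmP=> s t _ _ /permP/(_ (mk v 0 1)); rewrite !left_mulE => -[].
by rewrite !mulg1 => /invg_inj.
Qed.

Lemma climb_left_mul s x e : climb (left_mul s x) e = left_mul s (climb x e).
Proof.
rewrite !left_mulE; case: e => [e|v] //=; rewrite /pos /base /=.
by case: ifP => _ //=; rewrite mulgA.
Qed.

(** * Rigidity of the automorphisms of the tower graph *)

Lemma in_edge : 0 < k -> forall w : vert Gamma, exists e : edge Gamma, tgt e = w.
Proof.
move=> k0 w; have /card_gt0P[e] : 0 < #|out_edges w| by rewrite kG.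
(* The last edge of a path from the end of [e] back to [w] enters [w]; if the path is empty, [e]
   itself does. *)
rewrite inE => _; have /connectP[q] := cG (tgt e) w.
case/lastP: q => [_ ->|q u]; first by exists e.
rewrite rcons_path last_rcons => /andP[_ /existsP[d /andP[_ /eqP du]]] ->.
by exists d.
Qed.

(** Without edges, strong connectivity leaves at most one vertex. *)
Lemma rk0 : k = 0 -> forall v, rk v = 0.
Proof.
move=> k0 v; suff: #|vert Gamma| <= 1.
  by rewrite /rk; case: (enum_rank v) => [[|n]] //= lt_n /(leq_trans lt_n).
apply/card_le1P => u _ w; rewrite !inE.
have /connectP[[|y q] /= ] := cG u w; first by move=> _ ->; rewrite eqxx.
case/andP=> /existsP[e /andP[se _]]; have /eqP := kG u.
by rewrite k0 cards_eq0 => /eqP/setP/(_ e); rewrite !inE se.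
Qed.

(** An automorphism-invariant property that characterizes height 0 when [k > 0]. *)
Definition merging (x : vert tower_graph) : Prop :=
  exists e1 e2 : edge tower_graph, [/\ e1 != e2, tgt e1 = x & tgt e2 = x].

Lemma aut_merging f x : f \in AutG tower_graph -> merging x -> merging (f.1 x).
Proof.
move=> fA [d [e [de dx ex]]]; exists (f.2 d), (f.2 e).
by rewrite (inj_eq perm_inj) !aut_tgt // dx ex.
Qed.

Lemma merging_pos0 x : merging x -> pos x = 0.
Proof.
(* The only edge into a vertex of positive height is the lifted loop from the vertex just below. *)
have unique (z : edge tower_graph) : 0 < pos (tgt z) ->
    val z = (mk (base (tgt z)) (pos (tgt z)).-1 (tgt z).2, inr (base (tgt z))).
  case: z => [[y [e|v]] /= sy]; first by rewrite mk_pos.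
  case: ifP => lt_y; last by rewrite mk_pos.
  rewrite mk_pos // [base (mk _ _ _)]/= (eqP sy) => _.
  by congr (_, _); exact: (esym (mkE y)).
case=> d [e [de dx ex]]; apply/eqP; rewrite -leqn0 leqNgt; apply: contra de.
by move=> x0; apply/eqP/val_inj; rewrite !unique ?dx ?ex.
Qed.

Lemma pos0_merging w t : 0 < k -> merging (mk w 0 t).
Proof.
move=> k0; have [e <-] := in_edge k0 w.
have se : @src (add_loops Gamma) (inl e) == base (mk (src e) 0 t) by [].
(* The second incoming edge is the reset of the same tower; its group coordinate is chosen so that
   it lands on [t]. *)
have sw : @src (add_loops Gamma) (inr (tgt e))
    == base (mk (tgt e) (rk (tgt e)) (t * (g (tgt e))^-1)) by [].
exists (lift_out climb se), (lift_out climb sw); split => //.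
  by apply/eqP=> /(congr1 (fun z => (val z).2)).
by rewrite /= mk_pos // ltnn mulgKV.
Qed.

Lemma aut_pos0 f x : f \in AutG tower_graph -> pos x = 0 -> pos (f.1 x) = 0.
Proof.
move=> fA x0; have [k0|] := posnP k.
  by apply/eqP; rewrite -leqn0 (leq_trans (pos_le _)) ?rk0.
move=> k0; apply: merging_pos0; apply: aut_merging fA _.
by rewrite -(mkE x) x0; apply: pos0_merging.
Qed.

(** Induction on [i]: the image of a climbing edge ends at nonzero height, so it climbs too, and the
    image tower must be tall enough for this. *)
Lemma aut_tower f v i t : f \in AutG tower_graph -> i <= rk v ->
  i <= rk (base (f.1 (mk v 0 t))) /\
  f.1 (mk v i t) = mk (base (f.1 (mk v 0 t))) i (f.1 (mk v 0 t)).2.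
Proof.
move=> fA; elim: i => [|i IH] lt_i.
  by have := mkE (f.1 (mk v 0 t)); rewrite aut_pos0 ?mk_pos // => ->.
have [le_i fi] := IH (ltnW lt_i).
have := aut_adj fA (adj_next t lt_i); rewrite fi => /tower_adj.
have pos_next : pos (f.1 (mk v i.+1 t)) != 0.
  apply/eqP=> /(aut_pos0 (AutG_inv fA)).
  by rewrite /= permK mk_pos.
rewrite mk_pos //= => -[[]|[_ fE]|[e _ fE]] //.
  by rewrite fE mk_pos in pos_next.
by rewrite fE mk_pos in pos_next.
Qed.

(** By [aut_tower], neither [f] nor its inverse sends a tower into a shorter one, and [rk] separates
    base vertices. *)
Lemma aut_base0 f v t : f \in AutG tower_graph -> base (f.1 (mk v 0 t)) = v.
Proof.
have le_rk h w u : h \in AutG tower_graph -> rk w <= rk (base (h.1 (mk w 0 u))).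
  by move=> hA; case: (aut_tower u hA (leqnn (rk w))).
move=> fA; set y := f.1 (mk v 0 t).
have y0 : pos y = 0 by apply: aut_pos0; rewrite ?mk_pos.
apply: rk_inj; apply/eqP; rewrite eqn_leq le_rk // andbT.
have := le_rk _ (base y) y.2 (AutG_inv fA).
by rewrite -y0 mkE /= /y permK.
Qed.

Lemma aut_left_mul f : f \in AutG tower_graph -> exists s, f.1 = left_mul s.
Proof.
move=> fA; pose h v t := (f.1 (mk v 0 t)).2.
have fE v i t : i <= rk v -> f.1 (mk v i t) = mk v i (h v t).
  by move=> le_i; have [_ ->] := aut_tower t fA le_i; rewrite aut_base0.
have h_inj v : injective (h v).
  move=> t u htu; have : f.1 (mk v 0 t) = f.1 (mk v 0 u) by rewrite !fE // htu.
  by move/perm_inj; case.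
have h_edge (e : edge Gamma) t : h (tgt e) t = h (src e) t.
  (* Between distinct towers only edges lifted from Gamma exist, and these keep the group
     coordinate. *)
  have [-> //|ne] := eqVneq (tgt e) (src e).
  have := aut_adj fA (adj_cross e 0 t); rewrite !fE // => /tower_adj /=.
  case=> [[_ /(congr1 base)/= te]|[_ /(congr1 base)/= te]|[d _ /(congr1 snd)]] //.
    by case/eqP: ne; apply: te.
  by case/eqP: ne; apply: te.
have h_const v w : h v =1 h w.
  have /connectP[q] := cG v w.
  elim: q v => [|u q IH] v /= => [_ ->//|/andP[/existsP[e] ]].
  move=> /andP[/eqP <- /eqP eu] qp wq t; rewrite -(IH u qp wq) -eu.
  by rewrite h_edge.
have h_gen v t : h v (t * g v) = h v t * g v.
  have := aut_adj fA (adj_reset v t); rewrite !fE // => /tower_adj /=.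
  rewrite mk_pos // => -[[]|[_ /(congr1 snd)]|[e _ /(congr1 snd)/= /h_inj]] //.
    by rewrite ltnn.
  (* If the image edge lifts a loop of Gamma at [v], injectivity of [h v] forces [g v = 1], and the
     identity still holds. *)
  by rewrite -[in RHS](mulg1 t) => /mulgI ->; rewrite !mulg1.
have hM v s t : h v (t * s) = h v t * s.
  suff: [forall v, forall t, h v (t * s) == h v t * s].
    by move/forallP/(_ v)/forallP/(_ t)/eqP.
  move: s {v t}; apply: gen_ind => [|s u Ps Pu|w].
  - by apply/forallP=> v; apply/forallP=> t; rewrite !mulg1.
  - apply/forallP=> v; apply/forallP=> t; rewrite !mulgA.
    move/forallP/(_ v)/forallP/(_ (t * s))/eqP: Pu => ->.
    by move/forallP/(_ v)/forallP/(_ t)/eqP: Ps => ->.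
  - apply/forallP=> v; apply/forallP=> t.
    by rewrite !(h_const v w) h_gen.
have [/card0_eq V0|/card_gt0P[v0 _]] := posnP #|vert Gamma|.
  by exists 1; apply/permP=> x; have := V0 (base x); rewrite inE.
(* [left_mul] inverts its parameter, hence the inverse here. *)
exists (h v0 1)^-1; apply/permP=> x; rewrite left_mulE invgK -{1}(mkE x) fE ?pos_le //.
rewrite (h_const _ v0) -[in h v0 _](mul1g x.2) hM.
by rewrite -[in RHS](mkE x).
Qed.

Lemma tower_Aut : [set f.1 | f in AutG tower_graph] = left_mul @* [set: T].
Proof.
rewrite morphimEdom; apply/setP=> a; apply/imsetP/imsetP=> [[f fA ->]|[s _ ->]].
  by have [s ->] := aut_left_mul fA; exists s.
have [f fA fs] := @lift_aut (add_loops Gamma) tower base climb (left_mul s)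
  (fun x => congr1 base (left_mulE s x)) (climb_left_mul s).
by exists f.
Qed.

Lemma tower_Aut_isog (v : vert Gamma) :
  AutG tower_graph / AutE tower_graph \isog [set: T].
Proof.
have iso := quotient_Aut_isog tower_Aut; apply: isog_trans iso _.
by rewrite isog_sym; apply: sub_isog; rewrite ?injm_left_mul.
Qed.

End Tower.

(** * Choice of generators and conclusion *)

Lemma exists_generating_map (V : finType) (gT : finGroupType) (K : {group gT}) :
  'm(K) <= #|V| -> exists g : V -> gT, <<[set g v | v : V]>> = K.
Proof.
have [B genB <-] := grank_witness K => le_B.
(* A minimal generating set is listed along the vertices; surplus vertices get the default 1, which
   generates nothing new. *)
exists (fun v => nth 1 (enum B) (enum_rank v)); rewrite -genB.
apply/eqP; rewrite eqEsubset !gen_subG; apply/andP; split; apply/subsetP=> b.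
  case/imsetP=> v _ ->; have [lt_v|ge_v] := ltnP (enum_rank v) (size (enum B)).
    by apply: mem_gen; rewrite -mem_enum mem_nth.
  by rewrite nth_default.
move=> Bb; apply/mem_gen/imsetP.
have lt_b : index b (enum B) < #|V|.
  by apply: leq_trans le_B; rewrite cardE index_mem mem_enum.
exists (enum_val (Ordinal lt_b)) => //.
by rewrite enum_valK nth_index ?mem_enum.
Qed.

Theorem theorem3p24 (k : nat) (Gamma : digraph)
    (hout : k_out Gamma k) (hconn : strongly_connected Gamma)
    (gT : finGroupType) (H : {group gT}) (hH : H :!=: 1)
    (hd : 'm(H) <= #|vert Gamma|) :
  (strongly_connected (add_loops Gamma) /\ k_out (add_loops Gamma) k.+1) /\
  exists (G : digraph) (rho : rel (vert G)),
    [/\ strongly_connected G /\ k_out G k.+1,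
        graph_congruence rho k.+1,
        graph_iso (quotient_graph rho) (add_loops Gamma),
        AutG G / AutE G \isog H &
        ~ totally_synchronizing G k.+1].
Proof.
have houtS := add_loops_k_out hout.
split; first by split; [apply: add_loops_connected | ].
(* [subg_of H] turns [H] into the full group of a type, the form that the tower construction
   takes. *)
have [g genT] : exists g : vert Gamma -> subg_of H,
    <<[set g v | v : vert Gamma]>> = [set: subg_of H].
  apply: (@exists_generating_map _ _ [group of [set: subg_of H]]).
  by rewrite -(isog_grank (isog_subg H)).
(* Left multiplication by this [s] is the fixed-point-free symmetry that prevents
   synchronization. *)
have [s _ s1] : exists2 s, s \in [set: subg_of H] & s != 1.
  by apply/trivgPn; rewrite -(isog_eq1 (isog_subg H)).
(* A nontrivial group needs at least one generator, so Gamma has a vertex. *)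
have [v0 _] : exists v0, v0 \in vert Gamma.
  apply/card_gt0P; apply: leq_trans hd; rewrite lt0n.
  have [B genB <-] := grank_witness H; apply: contra hH => /eqP/cards0_eq B0.
  by rewrite -genB B0 gen0.
have p_act := @base_climb Gamma (subg_of H) g.
have p_onto := @base_onto Gamma (subg_of H).
exists (tower_graph g), (@fiber_rel (add_loops Gamma) _ (@base _ _) (climb g)).
split.
- split; first exact: tower_connected.
  exact: lift_k_out.
- exact: fiber_congruence.
- exact: lift_quotient_iso.
- apply: isog_trans (tower_Aut_isog hout hconn genT v0) _.
  by rewrite isog_sym isog_subg.
- apply: (lift_not_totally_synchronizing (a := left_mul Gamma s)) => //.
  + by move=> x; rewrite left_mulE.
  + exact: climb_left_mul.
  + exact: (mk v0 0 1).
  + move=> x; rewrite left_mulE; apply: contra s1 => /eqP/(congr1 snd)/=.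
    by rewrite -[in RHS](mul1g x.2) => /mulIg/eqP; rewrite invg_eq1.
Qed.
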